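(* Define integers $b_{\mathcal{G}}(n)$, $n\ge0$, by $b_{\mathcal{G}}(0)=1$, $b_{\mathcal{G}}(1)=-1$, $b_{\mathcal{G}}(2)=-1$ and, for $n\ge3$, $$b_{\mathcal{G}}(n)=-\frac12\left(\sum_{k=0}^{n-2}b_{\mathcal{G}}(k)\binom{n}{k+1}+\sum_{k=0}^{n-1}b_{\mathcal{G}}(k)\binom{n+1}{k+1}\right).$$ Then $b_{\mathcal{G}}(2n)=b_{\mathcal{G}}(2n-1)$ for all $n\ge1$. *)

(* Defs.v *)
From mathcomp Require Import all_boot all_order all_algebra.
From mathcomp Require Import ring zify.
Set Implicit Arguments.
Unset Strict Implicit.
Unset Printing Implicit Defensive.
Import Order.TTheory GRing.Theory Num.Theory.
Local Open Scope ring_scope.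

(* The recurrence is an equality of rationals, so that the factor 1/2 is a
   genuine division. *)
Definition is_bG (b : nat -> int) : Prop :=
  [/\ b 0%N = 1, b 1%N = -1, b 2%N = -1
    & forall n : nat, (3 <= n)%N ->
        (b n)%:~R = - (1 / 2) *
          (\sum_(0 <= k < n.-1) b k * 'C(n, k.+1)%:Z
           + \sum_(0 <= k < n) b k * 'C(n.+1, k.+1)%:Z)%:~R :> rat].

Lemma is_bG_uniq (b b' : nat -> int) : is_bG b -> is_bG b' -> b =1 b'.
Proof.
move=> [b0 b1 b2 bS] [b0' b1' b2' bS'] n.
elim/ltn_ind: n => -[_|[_|[_|n IH]]]; rewrite ?b0 ?b1 ?b2 //.
apply: (@intr_inj rat); rewrite bS // bS' //; congr (_ * (_ + _)%:~R).
  by apply: eq_big_nat => k /andP[_ kn]; rewrite IH //; apply: ltn_trans kn _.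
by apply: eq_big_nat => k /andP[_ kn]; rewrite IH.
Qed.

(* Existence of an integer solution (integrality of the recurrence). Let L be
   the linear form on int[X] with L('X^n) = G_n (Genocchi numbers), given on
   falling factorials by L(X(X-1)...(X-j)) = (-1)^j sum_(k <= j) k! (j-k)!.
   It satisfies L(p(X) + p(X+1)) = 2 p'(0), and b(n) = - L(X^(n+2) (X+1)). *)
Module Existence.

Definition a (j : nat) : nat := (\sum_(k < j) k`! * (j.-1 - k)`!)%N.

Lemma aS j : (2 * a j.+1 = j.+1 * a j + 2 * j`!)%N.
Proof.
case: j => [|j]; first by rewrite /a big_ord1 big_ord0.
have e1 : a j.+2 = (\sum_(k < j.+1) k`! * (j.+1 - k)`! + j.+1`!)%N.
  by rewrite /a big_ord_recr /= subnn muln1.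
have e2 : a j.+2 = (j.+1`! + \sum_(k < j.+1) k.+1`! * (j - k)`!)%N.
  by rewrite /a big_ord_recl /= mul1n subn0.
have e3 : (j.+2 * a j.+1 = \sum_(k < j.+1) k`! * (j.+1 - k)`!
                          + \sum_(k < j.+1) k.+1`! * (j - k)`!)%N.
  rewrite /a big_distrr -big_split /=; apply: eq_bigr => k _.
  have kj := ltn_ord k; rewrite subSn // !factS.
  by have -> : j.+2 = ((j - k).+1 + k.+1)%N by [lia]; ring.
by rewrite e3; lia.
Qed.

Definition lam (j : nat) : int := (-1) ^+ j.+1 * (a j)%:Z.

Definition step (f : nat -> int) (j : nat) : int := f j.+1 + j%:Z * f j.
Definition M (n : nat) : nat -> int := iter n step lam.

Definition L (p : {poly int}) : int := \sum_(i < size p) p`_i * M i 0%N.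

Lemma LE N (p : {poly int}) : (size p <= N)%N -> L p = \sum_(i < N) p`_i * M i 0%N.
Proof.
move=> pN; rewrite /L (big_ord_widen _ (fun i => p`_i * M i 0%N) pN) big_mkcond.
by apply: eq_bigr => i _; case: ltnP => // ip; rewrite nth_default // mul0r.
Qed.

Lemma LD p q : L (p + q) = L p + L q.
Proof.
set N := maxn (size p) (size q).
rewrite (LE (size_polyD p q)) (@LE N p) ?leq_maxl // (@LE N q) ?leq_maxr //.
by rewrite -big_split; apply: eq_bigr => i _; rewrite coefD mulrDl.
Qed.

Lemma LZ c p : L (c *: p) = c * L p.
Proof.
rewrite (LE (size_scale_leq c p)) /L big_distrr /=.
by apply: eq_bigr => i _; rewrite coefZ mulrA.
Qed.

Lemma LXn n : L 'X^n = M n 0%N.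
Proof.
rewrite /L size_polyXn big_ord_recr /= big1 ?coefXn ?eqxx ?mul1r ?add0r //.
by move=> i _; rewrite coefXn (ltn_eqF (ltn_ord i)) mul0r.
Qed.

Definition ff (j : nat) : {poly int} := \prod_(i < j) ('X - (i%:Z)%:P).

Lemma ffS j : ff j.+1 = ff j * 'X - j%:Z *: ff j.
Proof. by rewrite /ff big_ord_recr /= mulrBr [X in _ - X]mulrC mul_polyC. Qed.

Lemma LM n j : L ('X^n * ff j) = M n j.
Proof.
elim: j n => [|j IH] n; first by rewrite /ff big_ord0 mulr1 LXn.
have e : 'X^n * ff j.+1 = 'X^(n.+1) * ff j + (- j%:Z) *: ('X^n * ff j) :> {poly int}.
  by rewrite ffS exprS -!mul_polyC rmorphN /=; ring.
by rewrite e LD LZ !IH /M /= /step; ring.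
Qed.

Definition sh (p : {poly int}) := p \Po ('X + 1).

Lemma ff_coef1 j : (ff j.+1)`_1 = (-1) ^+ j * (j`!)%:Z.
Proof.
have f0 i : (ff i.+1)`_0 = 0.
  by elim: i => [|i IH]; rewrite ffS coefB coefMX coefZ /= ?IH ?mulr0 ?mul0r subr0.
elim: j => [|j IH]; first by rewrite /ff big_ord1 coefB coefX coefC.
by rewrite ffS coefB coefMX coefZ /= f0 IH factS PoszM exprS; ring.
Qed.

Lemma sh_ffS j : sh (ff j.+1) = ('X + 1) * ff j.
Proof.
elim: j => [|j IH].
  by rewrite /sh /ff big_ord1 big_ord0 comp_polyB comp_polyX comp_polyC subr0 mulr1.
rewrite {1}/ff big_ord_recr /= -/(ff j.+1) /sh comp_polyM -/(sh _) IH.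
rewrite comp_polyB comp_polyX comp_polyC ffS -mul_polyC.
by rewrite -addn1 PoszD polyCD; ring.
Qed.

Lemma keyM n j : L ('X^n * ff j) + L (sh ('X^n * ff j)) = 2 * ('X^n * ff j)`_1.
Proof.
elim: n j => [|n IH] j.
  rewrite mul1r; case: j => [|j].
    rewrite /ff big_ord0 /sh comp_polyC coef1 /=.
    by rewrite -(expr0 'X) LXn /M /= /lam /a big_ord0.
  have -> : sh (ff j.+1) = ff j.+1 + j.+1%:Z *: ff j.
    by rewrite sh_ffS ffS -!mul_polyC -addn1 PoszD polyCD; ring.
  rewrite LD LZ -[ff j.+1]mul1r -[ff j]mul1r -(expr0 'X) !LM /M /=.
  rewrite expr0 mul1r ff_coef1 /lam; have := aS j; rewrite !exprS.
  move=> /(congr1 Posz); rewrite [RHS]PoszD !PoszM => e.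
  by transitivity ((-1) ^+ j * (2%:Z * (a j.+1) - j.+1%:Z * a j)); [ring | rewrite e; ring].
have e : 'X^(n.+1) * ff j = 'X^n * ff j.+1 + j%:Z *: ('X^n * ff j) :> {poly int}.
  by rewrite ffS exprS -!mul_polyC; ring.
have := IH j; have := IH j.+1; rewrite e /sh comp_polyD comp_polyZ !LD !LZ coefD coefZ.
by move=> *; lia.
Qed.

Lemma key p : L p + L (sh p) = 2 * p`_1.
Proof.
have keyX n c : L (c *: 'X^n) + L (sh (c *: 'X^n)) = 2 * (c *: 'X^n)`_1.
  have := keyM n 0; rewrite /ff big_ord0 mulr1 /sh comp_polyZ !LZ coefZ => e.
  by rewrite -mulrDr e; ring.
rewrite -[p]coefK poly_def.
elim/big_ind: _ => [|q r eq er|i _]; last exact: keyX.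
  by rewrite /sh comp_poly0 /L size_poly0 !big_ord0 coef0.
by rewrite /sh comp_polyD !LD coefD mulrDr -eq -er /sh; ring.
Qed.

Definition K p := - L (p * ('X * ('X + 1))).
Definition bb n := K 'X^(n.+1).

Lemma Ksum n : K (('X + 1) ^+ n) = \sum_(0 <= k < n) bb k * 'C(n, k.+1)%:Z.
Proof.
have K0 : K 1 = 0.
  rewrite /K mul1r; have -> : 'X * ('X + 1) = 'X^2 + 'X^1 :> {poly int} by ring.
  rewrite LD !LXn /M /= /step /lam /a !big_ord_recl !big_ord0 /=.
  by rewrite /bump /=.
have KD p q : K (p + q) = K p + K q by rewrite /K mulrDl LD opprD.
have KZ c p : K (c *: p) = c * K p by rewrite /K -scalerAl LZ mulrN.
rewrite addrC exprDn big_ord_recl big_mkord.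
rewrite KD expr1n bin0 mulr1n expr0 mulr1 K0 add0r.
elim/big_ind2: _ => [|p x q y <- <-|i _] //.
  by rewrite /K mul0r /L size_poly0 big_ord0 oppr0.
rewrite expr1n mul1r /bb mulrC -KZ; congr K.
by rewrite -natz scaler_nat.
Qed.

Lemma bbP n : 2 * bb n.+1 + (\sum_(0 <= k < n) bb k * 'C(n.+1, k.+1)%:Z
           + \sum_(0 <= k < n.+1) bb k * 'C(n.+2, k.+1)%:Z) = 0.
Proof.
have e1 := Ksum n.+1; have e2 := Ksum n.+2.
rewrite big_nat_recr //= binn mulr1 in e1.
rewrite big_nat_recr //= binn mulr1 in e2.
set q : {poly int} := 'X^(n.+2) * ('X + 1) * ('X - 1).
have e : K (('X + 1) ^+ n.+2) + K (('X + 1) ^+ n.+1) + bb n.+1 - bb n = - (L q + L (sh q)).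
  have -> : sh q = ('X + 1) ^+ n.+2 * ('X * ('X + 1)) + ('X + 1) ^+ n.+1 * ('X * ('X + 1)).
    rewrite /sh /q 2!comp_polyM comp_polyB comp_polyD comp_Xn_poly comp_polyX comp_polyC.
    by rewrite !exprS; ring.
  have -> : q = 'X^(n.+2) * ('X * ('X + 1)) + (-1) *: ('X^(n.+1) * ('X * ('X + 1))).
    by rewrite /q scaleN1r !exprS; ring.
  by rewrite !LD LZ /bb /K; ring.
have q1 : q`_1 = 0 by rewrite /q -mulrA coefXnM.
by move: e; rewrite key q1 e1 e2 mulr0 oppr0 => e; rewrite -[RHS]e; ring.
Qed.

End Existence.

Lemma is_bG_exists : exists b : nat -> int, is_bG b.
Proof.
exists Existence.bb; have P := Existence.bbP.
have b0 : Existence.bb 0 = 1.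
  rewrite /Existence.bb /Existence.K.
  have -> : 'X^1 * ('X * ('X + 1)) = 'X^3 + 'X^2 :> {poly int} by ring.
  rewrite Existence.LD !Existence.LXn /Existence.M /= /Existence.step.
  by rewrite /Existence.lam /Existence.a !big_ord_recl !big_ord0.
have b1 : Existence.bb 1 = -1.
  by have := P 0%N; rewrite big_geq // big_nat1 b0 bin1; lia.
have b2 : Existence.bb 2 = -1.
  by have := P 1%N; rewrite !big_nat_recr //= !big_geq // b0 b1 !bin1 (_ : 'C(3, 2) = 3%N) //; lia.
split=> // -[//|n] _; set T := (X in _ * X%:~R).
have e : 2 * Existence.bb n.+1 + T = 0 by exact: P.
have -> : T = - (2 * Existence.bb n.+1) by apply/eqP; rewrite -addr_eq0 addrC e.
by move: (Existence.bb _) => x; rewrite intrN intrM; field.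
Qed.

(* Main.v *)
Require Import Defs.
From mathcomp Require Import all_boot all_order all_algebra.
From mathcomp Require Import ring zify.
Import Order.TTheory GRing.Theory Num.Theory.
Local Open Scope ring_scope.

(** The form [L], with [L 'X^n] the Genocchi number [G_n], satisfies
    [L p + L (p(X + 1)) = 2 p'(0)], and the solution of the recurrence is
    [b n = - (G_(n+3) + G_(n+2))]; so the claim amounts to [G_(2n+3) = G_(2n+1)],
    and both are 0.  To see that odd Genocchi numbers vanish from index 3 on, put
    [T p = L p - L (p(-X)) - 2 p'(0)].  Applying the functional equation to [p]
    and to [p(1 - X)] gives [T p + T (p(X + 1)) = 0], and for [p = 'X^n] this
    reads [2 T 'X^n = 0] modulo lower powers; hence [T = 0]. *)

Import Existence.

Definition reflect_poly (p : {poly int}) := p \Po (- 'X).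

Lemma coef1_deriv (p : {poly int}) : p`_1 = p^`().[0].
Proof. by rewrite horner_coef0 coef_deriv mulr1n. Qed.

Lemma reflect_poly_coef1 p : (reflect_poly p)`_1 = - p`_1.
Proof.
rewrite !coef1_deriv deriv_comp derivN derivX hornerM horner_comp.
by rewrite !hornerE oppr0 mulrN1.
Qed.

(** [reflect_poly (sh p)] is p(1 - X), and 1 - (X + 1) = -X. *)
Lemma sh_reflect_sh p : sh (reflect_poly (sh p)) = reflect_poly p.
Proof.
rewrite /sh /reflect_poly -!comp_polyA; congr (p \Po _).
rewrite comp_polyD comp_polyC comp_polyX -scaleN1r comp_polyZ comp_polyX.
by rewrite scalerDr !scaleN1r addrNK.
Qed.

Definition T (p : {poly int}) : int := L p - L (reflect_poly p) - 2 * p`_1.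

Lemma TD p q : T (p + q) = T p + T q.
Proof. by rewrite /T /reflect_poly comp_polyD !LD coefD; ring. Qed.

Lemma TZ c p : T (c *: p) = c * T p.
Proof. by rewrite /T /reflect_poly comp_polyZ !LZ coefZ; ring. Qed.

Lemma T_sh p : T p + T (sh p) = 0.
Proof.
have := key p; have := key (reflect_poly (sh p)).
rewrite sh_reflect_sh reflect_poly_coef1 /T; lia.
Qed.

Lemma T_Xn n : T 'X^n = 0.
Proof.
elim/ltn_ind: n => n IH; have := T_sh 'X^n.
rewrite /sh comp_Xn_poly exprD1n big_ord_recr /= binn mulr1n TD.
suff -> : T (\sum_(i < n) 'X^i *+ 'C(n, i)) = 0 by lia.
elim/big_ind: _ => [|p q p0 q0|i _]; last by rewrite -scaler_nat TZ IH ?mulr0.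
  by rewrite -(scale0r 0) TZ mul0r.
by rewrite TD p0 q0.
Qed.

(** For odd n, X -> -X negates ['X^n], so [T 'X^n] is 2 [L 'X^n] minus twice the coefficient of X,
    which is 0 once n > 1. *)
Lemma L_odd_Xn n : odd n -> (1 < n)%N -> L 'X^n = 0.
Proof.
move=> n_odd n_gt1; have := T_Xn n.
rewrite /T /reflect_poly comp_Xn_poly exprNn -signr_odd n_odd expr1 mulN1r.
rewrite -(scaleN1r 'X^n) LZ coefXn (ltn_eqF n_gt1) mulr0 mulN1r; move: (L _) => x; lia.
Qed.

Lemma bbE n : bb n = - (L 'X^(n.+3) + L 'X^(n.+2)).
Proof. by rewrite /bb /K -LD; congr (- L _); rewrite !exprS; ring. Qed.

Lemma bb0 : bb 0 = 1.
Proof.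
rewrite bbE !LXn /M /= /step /lam /a.
by rewrite !big_ord_recl !big_ord0.
Qed.

(** Cleared of its denominator, the recurrence also yields the given values at 1 and 2, so a later
    induction has the single base case [b 0]. *)
Lemma is_bG_rec b : is_bG b -> forall n,
  2 * b n.+1 + (\sum_(0 <= k < n) b k * 'C(n.+1, k.+1)%:Z
           + \sum_(0 <= k < n.+1) b k * 'C(n.+2, k.+1)%:Z) = 0.
Proof.
move=> [b0 b1 b2 bS] [|[|n]].
- by rewrite big_geq // big_nat1 b0 b1.
- by rewrite big_nat1 !big_nat_recr //= big_geq // b0 b1 b2.
apply: (@intr_inj rat); rewrite intrD intrM bS //=.
by field.
Qed.

Lemma is_bG_bb b : is_bG b -> b =1 bb.
Proof.
move=> hb; have [b0 _ _ _] := hb; elim/ltn_ind => -[_|n IH]; first by rewrite b0 bb0.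
have := is_bG_rec b hb n; have := bbP n.
have eq_sum (m N : nat) : (m <= n.+1)%N ->
    \sum_(0 <= k < m) b k * 'C(N, k.+1)%:Z = \sum_(0 <= k < m) bb k * 'C(N, k.+1)%:Z.
  by move=> mn; apply: eq_big_nat => k /andP[_ km]; rewrite IH // (leq_trans km).
by rewrite !eq_sum //; lia.
Qed.

Theorem mainTheorem20 (b : nat -> int) (hb : is_bG b) (n : nat)
  (hn : (1 <= n)%N) : b (2 * n)%N = b (2 * n - 1)%N.
Proof.
rewrite !(is_bG_bb b hb) !bbE.
have -> : (2 * n - 1).+3 = (2 * n).+2 by lia.
have -> : (2 * n - 1).+2 = (2 * n).+1 by lia.
(* Both sides contain G_(2n+2); the other indices, 2n+3 and 2n+1, are odd and exceed 1 because n >=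
   1. *)
by rewrite (L_odd_Xn (2 * n).+3) ?(L_odd_Xn (2 * n).+1) ?add0r ?addr0 //; lia.
Qed.
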